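(* Every holomorphic isometry of the complex hyperbolic plane $\mathrm{H}^2_{\mathbb{C}}$ is a commutator of holomorphic isometries: for every $C\in\mathrm{PU}(2,1)$ there exist $A,B\in\mathrm{PU}(2,1)$ such that $C=ABA^{-1}B^{-1}$.
   Context: $\mathrm{U}(2,1)\subset \mathrm{GL}(3,\mathbb{C})$ is the unitary group of a Hermitian form of signature $(2,1)$ on $\mathbb{C}^3$, and $\mathrm{PU}(2,1)$ is its image in $\mathrm{PGL}(3,\mathbb{C})$; it is the group of holomorphic isometries of $\mathrm{H}^2_{\mathbb{C}}$, the set of negative lines in $\mathbb{CP}^2$ with the Bergman metric. *)

(* Defs.v *)
From HB Require Import structures.
From mathcomp Require Import all_boot all_order all_algebra.
From mathcomp Require Import sesquilinear.
From mathcomp Require Import complex.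
From mathcomp Require Import classical_sets reals.

Set Implicit Arguments.
Unset Strict Implicit.
Unset Printing Implicit Defensive.

Import Order.TTheory GRing.Theory Num.Theory.
Local Open Scope ring_scope.
Local Open Scope quotient_scope.

(* The library's {'GL_n[R]} requires a finite ring, hence this infinite
   analogue. *)
Section GeneralLinear.
Variables (F : fieldType) (n : nat).

Record GL := MkGL { GLmx : 'M[F]_n; GLmx_unit : GLmx \in unitmx }.

HB.instance Definition _ := [isSub for GLmx].
HB.instance Definition _ := [Choice of GL by <:].

Implicit Types g h : GL.

Definition GL_one : GL := MkGL (unitmx1 F n).

Lemma GL_inv_subproof g : invmx (GLmx g) \in unitmx.
Proof. by rewrite unitmx_inv GLmx_unit. Qed.
Definition GL_inv g : GL := MkGL (GL_inv_subproof g).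

Lemma GL_mul_subproof g h : GLmx g *m GLmx h \in unitmx.
Proof. by rewrite unitmx_mul !GLmx_unit. Qed.
Definition GL_mul g h : GL := MkGL (GL_mul_subproof g h).

Lemma GL_mulA : associative GL_mul.
Proof. by move=> g h k; apply: val_inj; rewrite /= mulmxA. Qed.
Lemma GL_mul1 : left_id GL_one GL_mul.
Proof. by move=> g; apply: val_inj; rewrite /= mul1mx. Qed.
Lemma GL_mulr1 : right_id GL_one GL_mul.
Proof. by move=> g; apply: val_inj; rewrite /= mulmx1. Qed.
Lemma GL_mulV : left_inverse GL_one GL_inv GL_mul.
Proof. by move=> g; apply: val_inj; rewrite /= mulVmx ?GLmx_unit. Qed.
Lemma GL_mulrV : right_inverse GL_one GL_inv GL_mul.
Proof. by move=> g; apply: val_inj; rewrite /= mulmxV ?GLmx_unit. Qed.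

HB.instance Definition _ :=
  isGroup.Build GL GL_mulA GL_mul1 GL_mulr1 GL_mulV GL_mulrV.

End GeneralLinear.

Section ProjectiveLinear.
Variables (F : fieldType) (n : nat).
Local Notation GL := (GL F n).
Implicit Types g h k : GL.

(* Equality of the cosets of g and h modulo the scalar matrices. *)
Definition GL_scaleq : rel GL := fun g h => is_scalar_mx (GLmx (g^-1 * h)%g).

Lemma GL_scaleqP g h :
  reflect (exists2 a, a != 0 & GLmx h = a *: GLmx g) (GL_scaleq g h).
Proof.
apply: (iffP (is_scalar_mxP (A := GLmx (g^-1 * h)%g))) => /= [[a Ea]|[a _ Ea]].
  have Eh : GLmx h = a *: GLmx g.
    by rewrite -[GLmx h](mulKVmx (GLmx_unit g)) Ea mul_mx_scalar.
  have [a0|a_neq0] := eqVneq a 0; last by exists a.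
  have h0 : GLmx h = 0 by rewrite Eh a0 scale0r.
  have E1 : 1%:M = 0 :> 'M[F]_n.
    by rewrite -(mulmxV (GLmx_unit h)) h0 mul0mx.
  have E0 (M : 'M[F]_n) : M = 0 by rewrite -[M]mulmx1 E1 mulmx0.
  by exists 1; rewrite ?oner_eq0 // (E0 (GLmx h)) [RHS]E0.
by exists a; rewrite Ea -scalemxAr mulVmx ?GLmx_unit // scalemx1.
Qed.

Lemma GL_scaleq_refl : reflexive GL_scaleq.
Proof. by move=> g; apply/GL_scaleqP; exists 1; rewrite ?oner_eq0 ?scale1r. Qed.

Lemma GL_scaleq_sym : symmetric GL_scaleq.
Proof.
suff imp g h : GL_scaleq g h -> GL_scaleq h g.
  by move=> g h; apply/idP/idP; apply: imp.
case/GL_scaleqP=> a a0 E; apply/GL_scaleqP; exists a^-1; first by rewrite invr_eq0.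
by rewrite E scalerA mulVf ?scale1r.
Qed.

Lemma GL_scaleq_trans : transitive GL_scaleq.
Proof.
move=> g h k /GL_scaleqP[a a0 Ea] /GL_scaleqP[b b0 Eb]; apply/GL_scaleqP.
by exists (b * a); rewrite ?mulf_neq0 // Eb Ea scalerA.
Qed.

Canonical GL_scaleq_equiv :=
  EquivRel GL_scaleq GL_scaleq_refl GL_scaleq_sym GL_scaleq_trans.

Definition PGL := {eq_quot GL_scaleq}.

HB.instance Definition _ := Choice.on PGL.
HB.instance Definition _ := EqQuotient.on PGL.

Definition PGL_one : PGL := \pi_PGL 1%g.
Definition PGL_inv := lift_op1 PGL (fun g => g^-1)%g.
Definition PGL_mul := lift_op2 PGL (fun g h => g * h)%g.

Lemma pi_PGL_inv : {morph \pi_PGL : g / (g^-1)%g >-> PGL_inv g}.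
Proof.
move=> g; unlock PGL_inv; apply/eqmodP/GL_scaleqP.
case: piP => h /eqmodP/GL_scaleqP[a a0 /= E].
by exists a^-1; rewrite ?invr_eq0 //= E invmxZ ?unitmxZ ?unitfE ?GLmx_unit.
Qed.
Canonical PGL_inv_morph := PiMorph1 pi_PGL_inv.

Lemma pi_PGL_mul : {morph \pi_PGL : g h / (g * h)%g >-> PGL_mul g h}.
Proof.
move=> g h; unlock PGL_mul; apply/eqmodP/GL_scaleqP.
case: piP => g' /eqmodP/GL_scaleqP[a a0 /= Eg].
case: piP => h' /eqmodP/GL_scaleqP[b b0 /= Eh].
by exists (a * b); rewrite ?mulf_neq0 //= Eg Eh -scalemxAl -scalemxAr scalerA.
Qed.
Canonical PGL_mul_morph := PiMorph2 pi_PGL_mul.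

Lemma PGL_mulA : associative PGL_mul.
Proof.
by move=> x y z; rewrite -[x]reprK -[y]reprK -[z]reprK -!pi_PGL_mul mulgA.
Qed.
Lemma PGL_mul1 : left_id PGL_one PGL_mul.
Proof. by move=> x; rewrite -[x]reprK -pi_PGL_mul mul1g. Qed.
Lemma PGL_mulr1 : right_id PGL_one PGL_mul.
Proof. by move=> x; rewrite -[x]reprK -pi_PGL_mul mulg1. Qed.
Lemma PGL_mulV : left_inverse PGL_one PGL_inv PGL_mul.
Proof. by move=> x; rewrite -[x]reprK -pi_PGL_inv -pi_PGL_mul mulVg. Qed.
Lemma PGL_mulrV : right_inverse PGL_one PGL_inv PGL_mul.
Proof. by move=> x; rewrite -[x]reprK -pi_PGL_inv -pi_PGL_mul mulgV. Qed.

HB.instance Definition _ :=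
  isGroup.Build PGL PGL_mulA PGL_mul1 PGL_mulr1 PGL_mulV PGL_mulrV.

End ProjectiveLinear.

(* Some basis, given by the columns of P, has Gram matrix diag(1_p, -1_q). *)
Definition has_signature (C : numClosedFieldType) (p q : nat)
    (h : {hermitian_sym 'cV[C]_(p + q) for Num.conj}) : Prop :=
  exists2 P : 'M[C]_(p + q), P \in unitmx &
    \matrix_(i, j) h (col i P) (col j P) =
      block_mx 1%:M 0 0 (- 1%:M) :> 'M[C]_(p + q).

Local Open Scope classical_set_scope.

Definition unitary_group (C : numClosedFieldType) (n : nat)
    (h : {hermitian_sym 'cV[C]_n for Num.conj}) : set (GL C n) :=
  [set g | isometry h h (mulmx (GLmx g))].

Definition projective_unitary_group (C : numClosedFieldType) (n : nat)
    (h : {hermitian_sym 'cV[C]_n for Num.conj}) : set (PGL C n) :=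
  [set \pi_(PGL C n) g | g in unitary_group h].

(* Main.v *)
Require Import Defs.
From mathcomp Require Import all_boot all_order all_algebra.
From mathcomp Require Import sesquilinear complex.
From mathcomp Require Import boolp classical_sets reals ring.

Set Implicit Arguments.
Unset Strict Implicit.
Unset Printing Implicit Defensive.

Import Order.TTheory GRing.Theory Num.Theory.
Local Open Scope ring_scope.
Local Open Scope quotient_scope.

(** The product [T = X * B^-1] is a commutator as soon as [X] and [B] are
    conjugate in the unitary group: if [X = A * B * A^-1], then
    [T = A * B * A^-1 * B^-1].  The idea is to take [X] and [B = T^-1 * X]
    loxodromic with the same real eigenvalues 2 and 1/2, because such an
    isometry is determined up to conjugacy by these eigenvalues and its
    determinant ([loxodromic_diagonalizable]): the eigenlines of 2 and 1/2 are
    null and span a hyperbolic plane, whose positive orthogonal line carries the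
    third eigenvalue.

    To get both at once, let [v] and [w] be null vectors with [h w v = 1], and
    prescribe [X w = 2 w] and [X v = T v / 2].  Then 2 is an eigenvalue of [X],
    and [B v = v / 2]; since the spectrum of an isometry is stable under
    [l |-> 1 / l^*], each of [X] and [B] has both eigenvalues.  By Witt's
    extension principle ([witt_completion], [gram_isometry]) such an isometry
    [X] exists when the null pair [(w, v)] and its image [(2 w, T v / 2)] have
    the same mutual product, that is, when [h w (T v) = 1] as well.  Finally
    [det X = det B] when [det T = 1].

    So a null [v] is needed for which some null [w] has the same product 1
    with [v] and with [T v].  Such a [w] is orthogonal to [T v - v], and it
    exists ([null_common_partner]) when [T v - v] is positive, that is, when
    ['Re (h (T v) v) < 0].  This sign can be obtained from the choice of the
    lift: the lifts of determinant 1 of a projective class differ by the cube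
    roots of unity, whose sum is zero, so if [h (T v) v != 0], then one of the
    three lifts has a negative real part ([cube_root_Re_lt0]).  There remain the
    [T] for which [h (T v) v = 0] for all null [v]; these are scalar
    ([scalar_of_null]), and their projective class is trivial. *)

(** * Three-dimensional matrices *)

Lemma ord3_ind (P : 'I_3 -> Prop) : P 0 -> P 1 -> P 2 -> forall i, P i.
Proof.
move=> P0 P1 P2 [[|[|[|//]]] lti]; [move: P0|move: P1|move: P2];
  by congr P; apply: val_inj.
Qed.

Lemma big_ord3 (V : nmodType) (F : 'I_3 -> V) : \sum_i F i = F 0 + F 1 + F 2.
Proof.
rewrite 3!big_ord_recr big_ord0 /= add0r.
by congr (F _ + F _ + F _); apply: val_inj.
Qed.

Lemma det_mx3 (R : comNzRingType) (M : 'M[R]_3) :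
  \det M = M 0 0 * (M 1 1 * M 2 2 - M 1 2 * M 2 1)
         - M 0 1 * (M 1 0 * M 2 2 - M 1 2 * M 2 0)
         + M 0 2 * (M 1 0 * M 2 1 - M 1 1 * M 2 0).
Proof.
(* Natural number indices let the nested liftings of ordinals compute. *)
pose m i j := M (inord i) (inord j).
have mE i j : M i j = m i j by rewrite /m !inord_val.
rewrite (expand_det_row _ 0) big_ord3 /cofactor.
do 3!rewrite (expand_det_row _ 0) big_ord_recr big_ord1 /cofactor !det_mx11.
rewrite !mxE !mE /= !(expr0, expr1, expr2); ring.
Qed.

Section Columns.
Variable K : fieldType.
Implicit Types (M N : 'M[K]_3) (x : 'cV[K]_3).

Lemma eq_col_mx M M' : (forall j, col j M = col j M') -> M = M'.
Proof.
by move=> eqM; apply/matrixP=> i j; have /colP/(_ i) := eqM j; rewrite !mxE.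
Qed.

Lemma col_mulmx M N j : col j (M *m N) = M *m col j N.
Proof. by rewrite !colE mulmxA. Qed.

Lemma col_mul_diag M d j : col j (M *m diag_mx d) = d 0 j *: col j M.
Proof. by apply/colP=> i; rewrite mul_mx_diag !mxE mulrC. Qed.

Lemma mulmx_col3 M x :
  M *m x = x 0 0 *: col 0 M + x 1 0 *: col 1 M + x 2 0 *: col 2 M.
Proof.
by apply/colP=> i; rewrite !mxE big_ord3 ![_ * x _ _]mulrC.
Qed.

Definition frame (a b c : 'cV[K]_3) : 'M[K]_3 :=
  \matrix_(i, j) ([:: a; b; c]`_j) i 0.

Lemma col_frame a b c :
  (col 0 (frame a b c) = a) * (col 1 (frame a b c) = b)
  * (col 2 (frame a b c) = c).
Proof. by do !split; apply/colP=> i; rewrite !mxE. Qed.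

(** The Gram matrix of a Witt basis: two null vectors, in positions 0 and 2,
    with product 1, and between them a unit vector orthogonal to both. *)
Definition anti_id : 'M[K]_3 := \matrix_(i, j) (i + j == 2)%N%:R.

End Columns.

Arguments anti_id {K}.

(** * Cube roots in a prescribed half-plane *)

(** As [d] runs over the three cube roots of [D], the numbers [d * z] are the
    vertices of an equilateral triangle centred at 0, so they cannot all lie in
    the half-plane of nonnegative real part. *)
Lemma cube_root_Re_lt0 (K : numClosedFieldType) (D z : K) : D != 0 -> z != 0 ->
  exists2 d, d ^+ 3 = D & 'Re (d * z) < 0.
Proof.
move=> D0 z0; have [y ey] : exists y : K, y = 3.-root D * z by eexists.
have y0 : y != 0 by rewrite ey mulf_neq0 ?rootC_eq0.
pose s : K := sqrtC 3.
have s2 : s ^+ 2 = 3 by rewrite sqrtCK.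
have s0 : 0 < s by rewrite sqrtC_gt0 ltr0n.
have rs : s \is Num.real by rewrite gtr0_real.
(* For e = 1 and e = -1, these are the two nontrivial cube roots of 1. *)
have ro e : e ^+ 2 = 1 -> ((-1 + e * ('i * s)) / 2) ^+ 3 = 1.
  move=> e2; have is2 : (e * ('i * s)) ^+ 2 = - 3.
    by rewrite !exprMn e2 sqrCi s2 mul1r mulN1r.
  have -> : ((-1 + e * ('i * s)) / 2) ^+ 3 =
     (- 1 + 3 * (e * ('i * s)) + (e * ('i * s)) ^+ 2 * (e * ('i * s) - 3)) / 8.
    by field.
  by rewrite is2; field.
have Reo e : e \is Num.real ->
   'Re ((-1 + e * ('i * s)) / 2 * y) = - ('Re y + e * (s * 'Im y)) / 2.
  move=> re.
  have -> : (-1 + e * ('i * s)) / 2 * y = - 2^-1 * y + 'i * ((e * s / 2) * y).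
    by field.
  rewrite raddfD /= ReMil ReMl ?ImMl ?rpredN ?rpredM ?rpredV ?realn //.
  by field.
have cubes d : d ^+ 3 = 1 -> (d * 3.-root D) ^+ 3 = D.
  by move=> d3; rewrite exprMn d3 mul1r rootCK.
have [yn|yp] := real_ltP (Creal_Re y) (real0 K).
  by exists (1 * 3.-root D); rewrite ?cubes ?expr1n // mul1r -ey.
have finish e : e ^+ 2 = 1 -> e \is Num.real -> 0 < 'Re y + e * (s * 'Im y) ->
    exists2 d, d ^+ 3 = D & 'Re (d * z) < 0.
  move=> e2 re pos; exists ((-1 + e * ('i * s)) / 2 * 3.-root D).
    by rewrite cubes ?ro.
  by rewrite -(mulrA _ _ z) -ey Reo // mulNr oppr_lt0 divr_gt0 ?ltr0n.
have [Iy|Iy|Iy] := real_ltgtP (Creal_Im y) (real0 K).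
- apply: (finish (-1)); rewrite ?sqrrN ?expr1n ?rpredN ?rpred1 //.
  by rewrite ltr_wpDl // mulN1r -mulrN mulr_gt0 ?oppr_gt0.
- apply: (finish 1); rewrite ?expr1n ?rpred1 //.
  by rewrite ltr_wpDl // mul1r mulr_gt0.
- apply: (finish 1); rewrite ?expr1n ?rpred1 // Iy !mulr0 addr0 lt_def yp andbT.
  by apply: contraNneq y0 => Ry; rewrite [y]Crect Ry Iy mulr0 addr0.
Qed.

(** * Gram matrices and isometries *)

Section HermitianForm.
Variables (K : numClosedFieldType) (h : {hermitian_sym 'cV[K]_3 for Num.conj}).
Implicit Types (P Q S T : 'M[K]_3) (a b c p q r v w x y : 'cV[K]_3) (l : K).

Lemma form_conj x y : h x y = (h y x)^*.
Proof. by rewrite hermC mul1r. Qed.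

Definition gram Q : 'M[K]_3 := \matrix_(i, j) h (col i Q) (col j Q).

Lemma form_mulmx Q x y :
  h (Q *m x) (Q *m y) = (x^T *m gram Q *m map_mx Num.conj y) 0 0.
Proof.
rewrite !mulmx_col3 !linearDl !linearDr !linearZl_LR !linearZr_LR /=.
rewrite mxE big_ord3 !mxE !big_ord3 !mxE; ring.
Qed.

Lemma gramM Q S : gram (Q *m S) = S^T *m gram Q *m map_mx Num.conj S.
Proof.
apply/matrixP=> i j; rewrite !mxE !colE -!mulmxA form_mulmx -!colE.
rewrite !mxE; apply: eq_bigr => k _; rewrite !mxE; congr (_ * _).
by apply: eq_bigr => l _; rewrite !mxE.
Qed.

Lemma det_gram Q : \det (gram Q) = `|\det Q| ^+ 2 * \det (gram 1%:M).
Proof.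
rewrite -[in LHS](mul1mx Q) gramM !det_mulmx det_tr det_map_mx normCK.
by rewrite mulrAC.
Qed.

Lemma gram_frame a b c :
  h a a = 0 -> h b b = 1 -> h c c = 0 -> h a b = 0 -> h a c = 1 -> h b c = 0 ->
  gram (frame a b c) = anti_id.
Proof.
move=> haa hbb hcc hab hac hbc.
have [hba hca hcb] : [/\ h b a = 0, h c a = 1 & h c b = 0].
  by split; rewrite form_conj ?hab ?hac ?hbc ?conjC0 ?conjC1.
by apply/matrixP; do 2!elim/ord3_ind; rewrite !mxE !col_frame.
Qed.

Lemma form_witt Q i j :
  gram Q = anti_id -> h (col i Q) (col j Q) = (i + j == 2)%N%:R.
Proof. by move=> /matrixP/(_ i j); rewrite !mxE. Qed.

Lemma det_gram_unit Q : \det (gram Q) != 0 -> Q \in unitmx.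
Proof.
rewrite det_gram unitmxE unitfE; apply: contraNneq => ->.
by rewrite normr0 expr0n mul0r.
Qed.

Lemma witt_unitmx Q : gram Q = anti_id -> Q \in unitmx.
Proof.
move=> gQ; apply: det_gram_unit.
rewrite gQ det_mx3 !mxE [X in X != 0](_ : _ = -1); last by move=> /=; ring.
by rewrite oppr_eq0 oner_eq0.
Qed.

(** The linear map that sends one basis to another with the same Gram matrix is
    an isometry; applied to Witt bases, this is how isometries are prescribed on
    a null pair or on eigenvectors. *)
Lemma gram_isometry Q Q' :
  Q \in unitmx -> gram Q = gram Q' -> isometry h h (mulmx (Q' *m invmx Q)).
Proof.
move=> uQ gQ x y; rewrite -!mulmxA form_mulmx -gQ -form_mulmx.
by rewrite !mulKVmx.
Qed.

Lemma isometry_gram T : isometry h h (mulmx T) -> gram T = gram 1%:M.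
Proof.
by move=> isoT; apply/matrixP=> i j; rewrite !mxE -[RHS]isoT -!col_mulmx mulmx1.
Qed.

(** Two linear conditions on a space of dimension 3; the matrix [A] of the proof
    is made square, and singular, by a zero column. *)
Lemma form_orthogonal a c : exists2 b, b != 0 & h b a = 0 /\ h b c = 0.
Proof.
pose A : 'M[K]_3 :=
  \matrix_(i, j) [:: h (delta_mx i 0) a; h (delta_mx i 0) c]`_j.
have /det0P[v v0 vA] : \det A == 0.
  by rewrite det_mx3 !mxE /= !(mul0r, mulr0, subr0, addr0).
have hv y : h v^T y = \sum_i v 0 i * h (delta_mx i 0) y.
  rewrite [v^T]matrix_sum_delta linear_sumlz; apply: eq_bigr => i _.
  by rewrite big_ord1 linearZl_LR mxE.
exists v^T; first by rewrite trmx_eq0.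
split; [have /rowP/(_ 0) := vA|have /rowP/(_ 1) := vA];
  by rewrite !mxE hv => {2}<-; apply: eq_bigr => i _; rewrite !mxE.
Qed.

Section Signature.
Hypothesis sign_h : has_signature (p := 2) (q := 1) h.

(** * Hyperbolic pairs in signature (2,1) *)

Lemma signature_basis : exists2 P : 'M[K]_3, P \in unitmx &
  gram P = diag_mx (\row_j (-1) ^+ (j == 2)).
Proof.
case: sign_h => P uP gP; exists P => //.
rewrite /gram gP; apply/matrixP=> i j; rewrite !mxE.
case: split_ordP => k ->; rewrite mxE; case: split_ordP => l ->;
  rewrite !mxE -?val_eqE /= ?(ord1 k) ?(ord1 l) /=.
- by case: k l => [[|[|//]] ?] [[|[|//]] ?].
- by case: k => [[|[|//]] ?].
- by case: l => [[|[|//]] ?].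
- by rewrite expr1.
Qed.

(** A change of basis multiplies the determinant of the Gram matrix by a positive
    number, so the sign of this determinant depends on the signature only. *)
Lemma det_gram_lt0 Q : Q \in unitmx -> \det (gram Q) < 0.
Proof.
have [P uP gP] := signature_basis.
have gt0 A : A \in unitmx -> 0 < `|\det A : K| ^+ 2.
  by rewrite unitmxE unitfE => dA; rewrite exprn_gt0 ?normr_gt0.
have : \det (gram P) < 0.
  by rewrite gP det_diag !big_ord_recr big_ord0 !mxE /= !expr0 !mul1r ltrN10.
by move=> + uQ; rewrite (det_gram P) (det_gram Q) !pmulr_rlt0 ?gt0.
Qed.

Lemma form_nondegenerate x : x != 0 -> exists y, h x y != 0.
Proof.
move=> x0; have uG : gram 1%:M \in unitmx.
  by rewrite unitmxE unitfE lt_eqF ?det_gram_lt0 ?unitmx1.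
have /rV0Pn[j xj] : x^T *m gram 1%:M != 0.
  apply: contraNneq x0 => xG; rewrite -trmx_eq0 -[x^T](mulmxK uG) xG.
  by rewrite mul0mx.
exists (delta_mx j 0); have := form_mulmx 1%:M x (delta_mx j 0).
by rewrite !mul1mx map_delta_mx -colE [_ 0 0]mxE => ->.
Qed.

(** The Gram matrix of [(a, b, c)] has determinant [- h b b]. *)
Lemma hyperbolic_orthogonal_gt0 a b c :
  h a a = 0 -> h c c = 0 -> h a c = 1 -> h b a = 0 -> h b c = 0 -> b != 0 ->
  0 < h b b.
Proof.
move=> haa hcc hac hba hbc b0.
have hca : h c a = 1 by rewrite form_conj hac conjC1.
have [hab hcb] : h a b = 0 /\ h c b = 0.
  by split; rewrite form_conj ?hba ?hbc conjC0.
have : frame a b c \in unitmx.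
  rewrite unitmxE unitfE -det_tr; apply/negP=> /det0P[v /negP v0 vQ].
  have : frame a b c *m v^T = 0 by rewrite -[RHS]trmx0 -vQ trmx_mul trmxK.
  rewrite mulmx_col3 !col_frame => comb.
  have:= congr1 (h ^~ c) comb; have:= congr1 (h ^~ a) comb.
  rewrite /= !linearDl !linearZl_LR /= !linear0l haa hba hca hac hbc hcc.
  rewrite !(mulr0, mulr1, addr0, add0r) => v2 v1.
  move: comb; rewrite v1 v2 !scale0r addr0 add0r => /eqP.
  rewrite scaler_eq0 (negPf b0) orbF => /eqP v3.
  case: v0; rewrite -trmx_eq0; apply/eqP/colP.
  by elim/ord3_ind; rewrite ?(v1, v2, v3) [RHS]mxE.
move=> /det_gram_lt0; rewrite det_mx3 !mxE !col_frame.
rewrite haa hab hac hba hbc hca hcb hcc.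
by rewrite [X in X < 0](_ : _ = - h b b) ?oppr_lt0; last by ring.
Qed.

Lemma witt_completion a c : h a a = 0 -> h c c = 0 -> h a c = 1 ->
  exists b, gram (frame a b c) = anti_id.
Proof.
move=> haa hcc hac; have [b b0 [hba hbc]] := form_orthogonal a c.
have hbb := hyperbolic_orthogonal_gt0 haa hcc hac hba hbc b0.
have s0 : sqrtC (h b b) > 0 by rewrite sqrtC_gt0.
exists ((sqrtC (h b b))^-1 *: b).
apply: gram_frame => //.
- rewrite linearZl_LR linearZr_LR /= conj_Creal ?rpredV ?gtr0_real //.
  by rewrite mulrA -expr2 exprVn sqrtCK mulVf ?gt_eqF.
- by rewrite linearZr_LR /= (form_conj a) hba conjC0 mulr0.
- by rewrite linearZl_LR /= hbc mulr0.
Qed.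

Lemma witt_coord a b c y : gram (frame a b c) = anti_id ->
  y = h y c *: a + h y b *: b + h y a *: c.
Proof.
move=> gQ; have hQ i j := form_witt i j gQ; have uQ := witt_unitmx gQ.
rewrite -[y](mulKVmx uQ); set x := invmx _ *m y.
move: (hQ 0 0) (hQ 0 1) (hQ 0 2) (hQ 1 0) (hQ 1 1) (hQ 1 2).
move: (hQ 2 0) (hQ 2 1) (hQ 2 2).
rewrite mulmx_col3 !col_frame /= => h20 h21 h22 h00 h01 h02 h10 h11 h12.
rewrite !linearDl !linearZl_LR /= h00 h01 h02 h10 h11 h12 h20 h21 h22.
by rewrite !(mulr0, mulr1, addr0, add0r).
Qed.

(** Any [u] with [h a u = 1] is made null by subtracting a multiple of [a],
    without changing its product with [a]. *)
Lemma null_partner a : a != 0 -> h a a = 0 -> exists2 d, h d d = 0 & h a d = 1.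
Proof.
move=> a0 haa; have [y hay] := form_nondegenerate a0.
have [u hau] : exists u, h a u = 1.
  by exists ((h a y)^-1^* *: y); rewrite linearZr_LR /= conjCK mulVf.
have hua : h u a = 1 by rewrite form_conj hau conjC1.
have huu : (h u u)^* = h u u by rewrite -form_conj.
exists (u - (h u u / 2) *: a).
  rewrite !linearDl !linearDr !linearNl !linearNr !linearZl_LR !linearZr_LR /=.
  by rewrite haa hau hua rmorphM fmorphV /= huu conjC_nat; field.
by rewrite linearDr linearNr linearZr_LR /= haa hau mulr0 subr0.
Qed.

(** A form of signature (2,1) has no totally isotropic plane: in a Witt basis
    [(a, b, d)], a vector orthogonal to [a] is [k *: a + l *: b], of square norm
    [`|l| ^+ 2]. *)
Lemma null_orthogonal_collinear a c : a != 0 ->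
  h a a = 0 -> h c c = 0 -> h c a = 0 -> exists k, c = k *: a.
Proof.
move=> a0 haa hcc hca; have [d hdd had] := null_partner a0 haa.
have [b gQ] := witt_completion haa hdd had.
have := witt_coord c gQ; rewrite hca scale0r addr0 => ec.
have hcb : h c b = 0.
  apply/eqP; rewrite -normr_eq0 -sqrf_eq0 normCK; apply/eqP.
  move: hcc; rewrite {1}ec linearDl !linearZl_LR /=.
  by rewrite (form_conj a) (form_conj b) hca conjC0 mulr0 add0r.
by exists (h c d); rewrite {1}ec hcb scale0r addr0.
Qed.

(** * Diagonalization of loxodromic isometries *)

Lemma isometry_unitmx T : isometry h h (mulmx T) -> T \in unitmx.
Proof.
move=> isoT; apply: det_gram_unit; rewrite isometry_gram //.
by rewrite lt_eqF ?det_gram_lt0 ?unitmx1.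
Qed.

Lemma isometry_invmx T :
  isometry h h (mulmx T) -> isometry h h (mulmx (invmx T)).
Proof.
by move=> isoT x y; have uT := isometry_unitmx isoT; rewrite -isoT !mulKVmx.
Qed.

Lemma isometry_det T : isometry h h (mulmx T) -> `|\det T| = 1.
Proof.
move=> isoT; have := det_gram T.
rewrite isometry_gram // -[LHS]mul1r => /mulIf E.
apply/eqP; rewrite -sqrp_eq1 // -E //.
by rewrite lt_eqF ?det_gram_lt0 ?unitmx1.
Qed.

Section Isometry.
Variable T : 'M[K]_3.
Hypothesis isoT : isometry h h (mulmx T).

(** The adjoint of [T] is its inverse, so the image of [T - l^-1] is orthogonal to
    the eigenvector [a], and [T - l^-1] is singular. *)
Lemma inverse_eigenvalue l a : l \is Num.real -> l != 0 -> a != 0 ->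
  T *m a = l *: a -> exists2 c : 'cV_3, c != 0 & T *m c = l^-1 *: c.
Proof.
move=> rl l0 a0 Ta.
have /det0P[v v0 vT] : \det (T - l^-1%:M)^T == 0.
  rewrite det_tr; apply: contraTT isT => dT.
  have uT : T - l^-1%:M \in unitmx by rewrite unitmxE unitfE.
  have [y] := form_nondegenerate a0; apply: contraNN => _.
  rewrite -[y](mulKVmx uT); set x := invmx _ *m y.
  rewrite mulmxBl mul_scalar_mx linearBr linearZr_LR /= conj_Creal ?rpredV //.
  rewrite -[X in _ - _ * X]isoT Ta linearZl_LR /= mulKf //.
  by rewrite subrr.
exists v^T; first by rewrite trmx_eq0.
apply/eqP; rewrite -subr_eq0 -mul_scalar_mx -mulmxBl.
by rewrite -[X in X *m _]trmxK -trmx_mul vT trmx0.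
Qed.

Lemma eigenvector_null l a : l \is Num.real -> l ^+ 2 != 1 ->
  T *m a = l *: a -> h a a = 0.
Proof.
move=> rl l2 Ta; have := isoT a a.
rewrite Ta linearZl_LR linearZr_LR /= conj_Creal // mulrA -expr2 => /eqP.
rewrite -[X in _ == X]mul1r -subr_eq0 -mulrBl mulf_eq0 subr_eq0 (negPf l2).
by move/eqP.
Qed.

(** The eigenvectors for [l] and [l^-1] are null by [eigenvector_null], and they
    are not orthogonal by [null_orthogonal_collinear], so they complete to a Witt
    basis; its middle vector spans the orthogonal of the other two and is therefore
    an eigenvector too.  The determinant gives the last eigenvalue.  All isometries
    with the same [l] and the same determinant are thus conjugate. *)
Lemma loxodromic_diagonalizable l a : l \is Num.real -> l != 0 -> l ^+ 2 != 1 ->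
  a != 0 -> T *m a = l *: a ->
  exists2 Q, gram Q = anti_id &
    T *m Q = Q *m diag_mx (\row_j [:: l; \det T; l^-1]`_j).
Proof.
move=> rl l0 l2 a0 Ta.
have [c c0 Tc] := inverse_eigenvalue rl l0 a0 Ta.
have haa := eigenvector_null rl l2 Ta.
have hcc : h c c = 0.
  by apply: (eigenvector_null _ _ Tc); rewrite ?rpredV // exprVn invr_eq1.
have hca : h c a != 0.
  apply/eqP=> hca; have [k ec] := null_orthogonal_collinear a0 haa hcc hca.
  move: Tc c0; rewrite ec -scalemxAr Ta !scalerA => /eqP.
  rewrite -subr_eq0 -scalerBl scaler_eq0 (negPf a0) orbF.
  rewrite scaler_eq0 (negPf a0) orbF mulrC -mulrBl mulf_eq0 subr_eq0.
  case/orP=> [/eqP el|->//]; case/eqP: l2.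
  by rewrite expr2 {1}el mulVf.
have [c' [Tc' hc'a hc'c']] :
    exists c', [/\ T *m c' = l^-1 *: c', h c' a = 1 & h c' c' = 0].
  exists ((h c a)^-1 *: c); rewrite -scalemxAr Tc !scalerA mulrC; split=> //.
    by rewrite linearZl_LR /= mulVf.
  by rewrite linearZl_LR linearZr_LR /= hcc !mulr0.
have hac' : h a c' = 1 by rewrite form_conj hc'a conjC1.
have [b gQ] := witt_completion haa hc'c' hac'.
have hba : h b a = 0 by have := form_witt 1 0 gQ; rewrite !col_frame.
have hbc : h b c' = 0 by have := form_witt 1 2 gQ; rewrite !col_frame.
have Tb : T *m b = h (T *m b) b *: b.
  rewrite {1}(witt_coord (T *m b) gQ).
  have -> : h (T *m b) a = 0.
    rewrite -[RHS](mulr0 l^-1) -hba -(isoT b a) Ta linearZr_LR /=.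
    by rewrite conj_Creal ?mulKf.
  have -> : h (T *m b) c' = 0.
    rewrite -[RHS](mulr0 l) -hbc -(isoT b c') Tc' linearZr_LR /=.
    by rewrite conj_Creal ?rpredV ?mulVKf.
  by rewrite !scale0r add0r addr0.
exists (frame a b c') => //; set Q := frame a b c'.
have TQ m : T *m b = m *: b ->
    T *m Q = Q *m diag_mx (\row_j [:: l; m; l^-1]`_j).
  move=> em; apply: eq_col_mx; apply: ord3_ind;
  by rewrite col_mulmx col_mul_diag !col_frame mxE.
suff <- : h (T *m b) b = \det T by apply: TQ.
have /(congr1 determinant) := TQ _ Tb; rewrite !det_mulmx mulrC => /mulfI -> //.
  rewrite det_diag 3!big_ord_recr big_ord0 !mxE /= mul1r mulrAC mulfV //.
  by rewrite mul1r.
by rewrite -unitfE -unitmxE (witt_unitmx gQ).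
Qed.

End Isometry.

(** * Isometries moving a null line *)

Section ScalarOfNull.
Variable T : 'M[K]_3.
Hypothesis nullT : forall v, h v v = 0 -> h (T *m v) v = 0.

(** For [`|x| = 1] the vector [x *: p + q] is null, and the vanishing there is a
    trigonometric polynomial in [x]; its three coefficients are recovered from
    the values at 1, -1 and 'i. *)
Lemma null_vanishing_signed p q : h p p = 1 -> h q q = -1 -> h p q = 0 ->
  [/\ h (T *m p) q = 0, h (T *m q) p = 0 & h (T *m q) q = - h (T *m p) p].
Proof.
move=> hpp hqq hpq; have hqp : h q p = 0 by rewrite form_conj hpq conjC0.
have E (x : K) : x * x^* = 1 ->
    h (T *m p) p + h (T *m q) q + (x * h (T *m p) q + x^* * h (T *m q) p) = 0.
  move=> xx; have := @nullT (x *: p + q).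
  rewrite mulmxDr -scalemxAr !linearDl !linearDr !linearZl_LR !linearZr_LR /=.
  rewrite hpp hqq hpq hqp.
  move=> <-; last by rewrite mulr1 xx !mulr0 addr0 add0r subrr.
  by rewrite (mulrA x x^*) xx; ring.
have E1 := E 1; rewrite conjC1 mulr1 !mul1r in E1.
have E2 := E (-1); rewrite rmorphN1 mulrNN mulr1 in E2.
have E3 := E 'i; rewrite conjCi mulrN -expr2 sqrCi opprK in E3.
move: (E1 erefl) (E2 erefl) (E3 erefl) => {}E1 {}E2 {}E3.
have two0 : 2 != 0 :> K by rewrite pnatr_eq0.
have s0 : h (T *m p) p + h (T *m q) q = 0.
  by apply: (mulfI two0); rewrite mulr0 -[RHS](addr0 0) -{1}E1 -E2; ring.
have a0 : h (T *m p) q + h (T *m q) p = 0 by rewrite s0 add0r in E1.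
have d0 : h (T *m p) q - h (T *m q) p = 0.
  by apply: (mulfI (neq0Ci K)); rewrite mulr0 -E3 s0; ring.
have hTpq : h (T *m p) q = 0.
  by apply: (mulfI two0); rewrite mulr0 -[RHS](addr0 0) -{1}a0 -d0; ring.
split=> //; first by rewrite hTpq add0r in a0.
by apply/eqP; rewrite -addr_eq0 addrC s0.
Qed.

(** The previous lemma also applies to every unit vector of the plane of [p] and
    [q].  So the form [h (T *m u) u] is constant on the unit sphere of that plane, and
    its off-diagonal terms vanish. *)
Lemma null_vanishing_spacelike p q r :
  h p p = 1 -> h q q = 1 -> h r r = -1 -> h p q = 0 -> h p r = 0 -> h q r = 0 ->
  h (T *m p) q = 0 /\ h (T *m q) p = 0.
Proof.
move=> hpp hqq hrr hpq hpr hqr.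
have hqp : h q p = 0 by rewrite form_conj hpq conjC0.
have [_ _ mp] := null_vanishing_signed hpp hrr hpr.
have [_ _] := null_vanishing_signed hqq hrr hqr; rewrite mp => /oppr_inj mq.
have E (x : K) : x * x^* = 1 -> x^* * h (T *m p) q + x * h (T *m q) p = 0.
  move=> xx.
  (* (3/5, 4/5) is a rational point of the unit circle off the axes. *)
  have hpp' : h ((3 / 5) *: p + (4 / 5 * x) *: q)
                ((3 / 5) *: p + (4 / 5 * x) *: q) = 1.
    rewrite !linearDl !linearDr !linearZl_LR !linearZr_LR /=.
    rewrite hpp hqq hpq hqp !rmorphM !fmorphV /= !conjC_nat.
    transitivity (9 / 25 + 16 / 25 * (x * x^*)); first by field.
    by rewrite xx; field.
  have := null_vanishing_signed hpp' hrr.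
  rewrite linearDl !linearZl_LR /= hpr hqr !mulr0 addr0 => /(_ erefl)[_ _].
  rewrite mp mulmxDr -!scalemxAr.
  rewrite !linearDl !linearDr !linearZl_LR !linearZr_LR /=.
  rewrite !rmorphM !fmorphV /= !conjC_nat -mq => /oppr_inj E.
  have := E.
  have {1}-> : h (T *m p) p = (9 / 25 + 16 / 25 * (x * x^*)) * h (T *m p) p.
    by rewrite xx; field.
  move/eqP; rewrite -subr_eq0 => /eqP E0.
  apply: (@mulfI _ (- 12 / 25)).
    by rewrite mulf_neq0 ?invr_eq0 ?oppr_eq0 ?pnatr_eq0.
  by rewrite mulr0 -E0; field.
have E1 := E 1; rewrite conjC1 !mul1r in E1.
have E3 := E 'i; rewrite conjCi mulrN -expr2 sqrCi opprK in E3.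
move: (E1 erefl) (E3 erefl) => {}E1 {}E3.
have d0 : h (T *m q) p - h (T *m p) q = 0.
  by apply: (mulfI (neq0Ci K)); rewrite mulr0 -E3; ring.
have two0 : 2 != 0 :> K by rewrite pnatr_eq0.
have hqp0 : h (T *m q) p = 0.
  by apply: (mulfI two0); rewrite mulr0 -[RHS](addr0 0) -{1}E1 -d0; ring.
by split=> //; rewrite hqp0 addr0 in E1.
Qed.

Lemma scalar_of_null : exists s, T = s%:M.
Proof.
have [P uP /matrixP gP] := signature_basis.
have hP i j : h (col i P) (col j P) = (-1) ^+ (j == 2) *+ (i == j).
  have := gP i j; rewrite !mxE => ->; by case: (eqVneq i j) => [->|].
have h22 : h (col 2 P) (col 2 P) = -1 by rewrite hP.
have [m02 m20 m22] := null_vanishing_signed (hP 0 0) h22 (hP 0 2).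
have [m12 m21] := null_vanishing_signed (hP 1 1) h22 (hP 1 2).
rewrite m22 => /oppr_inj/esym m11.
have [m01 m10] :=
  null_vanishing_spacelike (hP 0 0) (hP 1 1) h22 (hP 0 1) (hP 0 2) (hP 1 2).
exists (h (T *m col 0 P) (col 0 P)).
apply: (can_inj (mulmxK uP)); apply: eq_col_mx => j.
rewrite !col_mulmx mul_scalar_mx; apply/eqP; rewrite -subr_eq0.
apply/negPn/negP=> /form_nondegenerate[y]; apply/negP; rewrite negbK.
rewrite -[y](mulKVmx uP) (mulmx_col3 P) !linearDr !linearZr_LR /=.
rewrite !linearBl !linearZl_LR /= !hP.
move: j; apply: ord3_ind;
  rewrite ?(m01, m02, m10, m12, m20, m21, m22, m11) /=;
  by rewrite ?mulr0n ?mulr1n ?expr0 ?expr1; apply/eqP; ring.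
Qed.

End ScalarOfNull.

(** In a Witt basis [(v, b, c)] with [T v] proportional to [c], the two products
    with [w = x *: v + y *: b + k *: c] force [k = 1] and [x = 1 / z^*], where
    [z = h (T v) v].  Then [h w w = x + x^* + `|y| ^+ 2], and a suitable [y]
    exists because [x + x^*] has the sign of the real part of [z]. *)
Lemma null_common_partner T v : isometry h h (mulmx T) ->
  h v v = 0 -> 'Re (h (T *m v) v) < 0 ->
  exists w, [/\ h w w = 0, h w v = 1 & h w (T *m v) = 1].
Proof.
move=> isoT hvv; set z := h (T *m v) v => Rz.
have z0 : z != 0 by apply: contraTneq Rz => ->; rewrite raddf0 ltxx.
have [c [eTv hcc hcv]] : exists c, [/\ T *m v = z *: c, h c c = 0 & h c v = 1].
  exists (z^-1 *: (T *m v)).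
  rewrite scalerA mulfV // scale1r !linearZl_LR !linearZr_LR /= isoT hvv !mulr0.
  by rewrite mulVf.
have hvc : h v c = 1 by rewrite form_conj hcv conjC1.
have [b gQ] := witt_completion hvv hcc hvc.
have hbv : h b v = 0 by have := form_witt 1 0 gQ; rewrite !col_frame.
have hvb : h v b = 0 by have := form_witt 0 1 gQ; rewrite !col_frame.
have hbb : h b b = 1 by have := form_witt 1 1 gQ; rewrite !col_frame.
have hbc : h b c = 0 by have := form_witt 1 2 gQ; rewrite !col_frame.
have hcb : h c b = 0 by have := form_witt 2 1 gQ; rewrite !col_frame.
have [x ex] : exists x : K, x * z^* = 1.
  by exists (z^*)^-1; rewrite mulVf // conjC_eq0.
have [y ry y2] : exists2 y : K, y^* = y & y ^+ 2 = - (x + x^*).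
  exists (sqrtC (- (x + x^*))); last by rewrite sqrtCK.
  rewrite conj_Creal // ger0_real // sqrtC_ge0 oppr_ge0.
  have -> : x + x^* = 'Re x *+ 2 by rewrite ReE -mulr_natr divfK ?pnatr_eq0.
  have zc0 : z^* != 0 by rewrite conjC_eq0.
  have -> : x = (z^*)^-1 by apply: (mulIf zc0); rewrite ex mulVf.
  rewrite pmulrn_lle0 // ReV Re_conj pmulr_lle0 ?ltW //.
  by rewrite invr_gt0 exprn_gt0 ?normr_gt0.
exists (x *: v + y *: b + c); split.
- rewrite !linearDl !linearDr !linearZl_LR !linearZr_LR /=.
  rewrite hvv hvb hvc hbv hbb hbc hcv hcb hcc ry.
  by transitivity (x + x^* + y ^+ 2); [ring | rewrite y2 subrr].
- by rewrite !linearDl !linearZl_LR /= hvv hbv hcv !mulr0 !add0r.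
- rewrite eTv !linearDl !linearZl_LR !linearZr_LR /= hvc hbc hcc.
  by rewrite -[RHS]ex; ring.
Qed.

(** * Commutators *)

(** The matrix [X] of the proof sends the null pair [(w, v)] to
    [(2 *: w, 2^-1 *: T v)]; it has the eigenvector [w] for 2, and
    [B = T^-1 *m X] has the eigenvector [v] for [2^-1].  The conclusion is the
    commutator identity cleared of inverses. *)
Lemma isometry_commutator T v : isometry h h (mulmx T) -> \det T = 1 ->
  h v v = 0 -> 'Re (h (T *m v) v) < 0 ->
  exists A B : 'M[K]_3,
    [/\ isometry h h (mulmx A), isometry h h (mulmx B) &
        T *m B *m A = A *m B].
Proof.
move=> isoT dT hvv Rv.
have [w [hww hwv hwTv]] := null_common_partner isoT hvv Rv.
have uT := isometry_unitmx isoT.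
have two0 : 2 != 0 :> K by rewrite pnatr_eq0.
have r2 : (2 : K) \is Num.real by rewrite realn.
have rV2 : (2 : K)^-1 \is Num.real by rewrite rpredV.
have n4 : (2 : K) ^+ 2 != 1 by rewrite -natrX pnatr_eq1.
have [e gQ] := witt_completion hww hvv hwv.
have [e' gQ'] :
    exists e', gram (frame (2 *: w) e' (2^-1 *: (T *m v))) = anti_id.
  apply: witt_completion => //.
  - by rewrite linearZl_LR linearZr_LR /= hww !mulr0.
  - by rewrite linearZl_LR linearZr_LR /= isoT hvv !mulr0.
  - rewrite linearZl_LR linearZr_LR /= hwTv mulr1.
    by rewrite fmorphV /= conjC_nat mulfV.
set Q := frame w e v in gQ; set Q' := frame _ _ _ in gQ'.
have uQ := witt_unitmx gQ.
have [X isoX XQ] : exists2 X, isometry h h (mulmx X) & X *m Q = Q'.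
  exists (Q' *m invmx Q); last by rewrite mulmxKV.
  by apply: gram_isometry; rewrite // gQ gQ'.
have Xw : X *m w = 2 *: w.
  by rewrite -[w in LHS](col_frame w e v) -col_mulmx XQ col_frame.
have Xv : X *m v = 2^-1 *: (T *m v).
  by rewrite -[v in LHS](col_frame w e v) -col_mulmx XQ col_frame.
pose B := invmx T *m X.
have isoB : isometry h h (mulmx B).
  by move=> x y; rewrite -!mulmxA (isometry_invmx isoT) isoX.
have Bv : B *m v = 2^-1 *: v by rewrite -mulmxA Xv -scalemxAr mulKmx.
have [w0 v0] : w != 0 /\ v != 0.
  have := oner_neq0 K; rewrite -hwv => hwv0.
  by split; apply: contraNneq hwv0 => ->; rewrite ?linear0l ?linear0r.
have [c c0 Bc] := inverse_eigenvalue isoB rV2 (invr_neq0 two0) v0 Bv.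
rewrite invrK in Bc.
have [P gP XP] := loxodromic_diagonalizable isoX r2 two0 n4 w0 Xw.
have [P' gP' BP] := loxodromic_diagonalizable isoB r2 two0 n4 c0 Bc.
have uP' := witt_unitmx gP'.
exists (P *m invmx P'), B; split => //.
  by apply: gram_isometry; rewrite // gP gP'.
rewrite mulKVmx // mulmxA XP.
have -> : \det X = \det B by rewrite det_mulmx det_inv dT invr1 mul1r.
apply: (can_inj (mulmxK uP')).
by rewrite mulmxKV // -(mulmxA _ B) BP mulmxA mulmxKV.
Qed.

Lemma isometry_projective_commutator T : isometry h h (mulmx T) ->
  (exists s, T = s%:M) \/
  exists d, exists A B : 'M[K]_3,
    [/\ d != 0, isometry h h (mulmx A), isometry h h (mulmx B) &
        d *: T *m B *m A = A *m B].
Proof.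
move=> isoT.
have [nullT|] := pselect (forall v, h v v = 0 -> h (T *m v) v = 0).
  by left; apply: scalar_of_null.
move=> /existsNP[v /not_implyP[hvv /eqP hTv]]; right.
have dT : \det T != 0 by rewrite -unitfE -unitmxE isometry_unitmx.
have [d d3 Rd] := cube_root_Re_lt0 (invr_neq0 dT) hTv.
have d0 : d != 0 by apply: contraTneq Rd => ->; rewrite mul0r raddf0 ltxx.
(* The factor is unimodular, since the determinant of an isometry is. *)
have dd : d * d^* = 1.
  apply/eqP; rewrite -normCK sqrp_eq1 // -(@pexpr_eq1 _ _ 3) //.
  by rewrite -normrX d3 normfV isometry_det // invr1.
have isodT : isometry h h (mulmx (d *: T)).
  by move=> x y; rewrite -!scalemxAl linearZl_LR linearZr_LR /= mulrA dd mul1r.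
exists d; have [||A [B [isoA isoB E]]] := isometry_commutator isodT _ hvv.
- by rewrite detZ d3 mulVf.
- by rewrite -scalemxAl linearZl_LR.
by exists A, B.
Qed.

Lemma projective_unitary_commutator (C : PGL K 3) :
  projective_unitary_group h C ->
  exists A B : PGL K 3,
    [/\ projective_unitary_group h A, projective_unitary_group h B &
        C = (A * B * A^-1 * B^-1)%g].
Proof.
case=> g isog <-.
have [[s gs]|[d [A [B [d0 isoA isoB E]]]]] :=
  isometry_projective_commutator isog.
  have one : projective_unitary_group h 1%g.
    by exists 1%g => // x y; rewrite !mul1mx.
  exists 1%g, 1%g; split=> //; rewrite !invg1 !mulg1.
  apply/esym/eqmodP/GL_scaleqP; exists s; last by rewrite gs scalemx1.
  have := GLmx_unit g; rewrite gs unitmxE det_scalar; apply: contraTneq => ->.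
  by rewrite expr0n unitr0.
pose a := MkGL (isometry_unitmx isoA); pose b := MkGL (isometry_unitmx isoB).
exists (\pi_(PGL K 3) a), (\pi_(PGL K 3) b).
split; [by exists a|by exists b|].
have ug : d *: GLmx g \in unitmx by rewrite unitmxZ ?unitfE // GLmx_unit.
have -> : \pi_(PGL K 3) g = \pi_(PGL K 3) (MkGL ug).
  by apply/eqmodP/GL_scaleqP; exists d.
have : (MkGL ug * b * a = a * b)%g by apply: val_inj.
move=> /(congr1 \pi_(PGL K 3)); rewrite !pi_PGL_mul => E'.
apply: (canRL (mulgK _)); apply: (canRL (mulgK _)); exact: E'.
Qed.

End Signature.

End HermitianForm.

Local Open Scope complex_scope.

Theorem theorem5 (R : realType)
    (h : {hermitian_sym 'cV[R[i]]_3 for Num.conj})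
    (sign_h : has_signature (p := 2) (q := 1) h) :
  forall C : PGL R[i] 3, projective_unitary_group h C ->
  exists A B : PGL R[i] 3,
    [/\ projective_unitary_group h A, projective_unitary_group h B &
        C = (A * B * A^-1 * B^-1)%g].
Proof. exact: projective_unitary_commutator. Qed.
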